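(* Let $q$ be a fixed real number with $q\neq 1$, let $\mathbb{K}$ be either $\mathbb{R}$ or $\mathbb{C}$, let $n$ be a positive integer, and let $f$ be a $\mathbb{K}$-valued function of a variable $x\in\mathbb{K}$ for which the $n$th derivative $f^{(n)}(0)$ at $x=0$ exists (real derivative if $\mathbb{K}=\mathbb{R}$, complex derivative if $\mathbb{K}=\mathbb{C}$). Then $(\mathcal{D}_q^n f)(0)$ and $\lim_{x\to 0}\mathcal{D}_q^n f(x)$ exist, and $$\left(\mathcal{D}_q^n f\right)(0)=\lim_{x\to 0}\mathcal{D}_q^n f(x)=\frac{f^{(n)}(0)}{n!}\,\frac{(q;q)_n}{(1-q)^n}.$$
   Context: The $q$-derivative operator $\mathcal{D}_q$ is defined, for functions $f$ that are differentiable at $x=0$, by $$\mathcal{D}_q f(x):=\begin{cases}\dfrac{f(x)-f(qx)}{(1-q)x}, & x\neq 0,\\[2mm] f'(0), & x=0,\end{cases}$$ where, for $x\neq 0$, $\mathcal{D}_qf(x)$ is considered at those $x$ for which both $x$ and $qx$ lie in the domain of $f$. Iterates are defined by $\mathcal{D}_q^0 f:=f$ and $\mathcal{D}_q^n f:=\mathcal{D}_q(\mathcal{D}_q^{n-1}f)$ for $n=1,2,3,\ldots$. In particular $(\mathcal{D}_q^n f)(0)=(\mathcal{D}_q^{n-1}f)'(0)$. Convention: existence of a derivative of $f$ at $0$ includes that the domain of $f$ contains $0$ in its interior, i.e. $f$ is defined at least on $\{x\in\mathbb{K}: |x|<\rho\}$ for some $\rho>0$. Existence of $f^{(n)}(0)$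 for $n\ge 2$ means as usual that $f^{(n-1)}$ exists in a neighbourhood of $0$ and is differentiable at $0$. The functions $\mathcal{D}_q^n f$ are then considered on a neighbourhood of $0$ (possibly smaller than the domain of $f$ when $|q|>1$). The limit $x\to 0$ is taken over $x\neq 0$ in $\mathbb{K}$. The $q$-shifted factorial is $(a;q)_0:=1$ and $(a;q)_n:=\prod_{k=0}^{n-1}(1-aq^k)$ for $n\geq 1$ (with $q^0=1$, also when $q=0$), so $(q;q)_n=\prod_{k=1}^{n}(1-q^k)$. *)

(* Defs.v *)
From mathcomp Require Import all_boot all_order all_algebra.
From mathcomp Require Import all_classical all_reals all_analysis.
From mathcomp Require Import complex.

Set Implicit Arguments.
Unset Strict Implicit.
Unset Printing Implicit Defensive.

Import Order.TTheory GRing.Theory Num.Theory.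
Import numFieldNormedType.Exports.

Local Open Scope classical_set_scope.
Local Open Scope ring_scope.

Variant scalar_kind : Set := RealScalars | ComplexScalars.

Definition scalars (R : realType) (k : scalar_kind) : numFieldType :=
  match k with
  | RealScalars => R
  | ComplexScalars => R[i]
  end.

Definition of_real (R : realType) (k : scalar_kind) : R -> scalars R k :=
  match k return R -> scalars R k with
  | RealScalars => fun x => x
  | ComplexScalars => fun x => real_complex R x
  end.

Definition qshifted_factorial (K : pzRingType) (a q : K) (n : nat) : K :=
  \prod_(j < n) (1 - a * q ^+ j).

(* A partial function on K is encoded by its domain A : set K together with a
   total function f : K -> K whose values outside A are irrelevant. Operators
   on partial functions are split in the same way: qderive and f^`(n) give the
   values, qderive_dom and derive_dom the sets where these values make sense. *)
Section PartialFunctions.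
Context {K : numFieldType}.
Implicit Types (q : K) (A : set K) (f : K -> K).

Definition qderive q f : K -> K := fun x =>
  if x == 0 then f^`()%classic 0 else (f x - f (q * x)) / ((1 - q) * x).

Definition qderiven q (n : nat) f : K -> K := iter n (qderive q) f.

(* [derivable g x 1] refers to increments h -> 0 in K, so it is complex
   differentiability when K is the field of complex numbers. *)
Definition differentiable_in A f (x : K) : Prop :=
  interior A x /\ derivable f x 1.

Fixpoint derive_dom A f (n : nat) : set K :=
  match n with
  | 0 => A
  | m.+1 => [set x | differentiable_in (derive_dom A f m) f^`(m)%classic x]
  end.

Fixpoint qderive_dom q A f (n : nat) : set K :=
  match n with
  | 0 => A
  | m.+1 => [set x |
      if x == 0 then differentiable_in (qderive_dom q A f m) (qderiven q m f) 0
      else qderive_dom q A f m x /\ qderive_dom q A f m (q * x)]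
  end.

End PartialFunctions.

(* Main.v *)
Require Import Defs.
From mathcomp Require Import all_boot all_order all_algebra.
From mathcomp Require Import all_classical all_reals all_analysis.
From mathcomp Require Import complex.
From mathcomp Require Import ring.

(** By the Peano form of Taylor's theorem, [f = P + o(x^n)] with [P] the Taylor
    polynomial of [f] at 0. The q-derivative maps an expansion [P + o(x^(n+1))]
    to [P' + o(x^n)], where [P'] is the q-derivative of the polynomial [P], and
    an expansion of order at least 1 is differentiable at 0. After [n] steps the
    error is [o(1)], so the value and the limit at 0 of the [n]-th q-derivative
    are the constant term of the [n]-th q-derivative of [P]. *)

Set Implicit Arguments.
Unset Strict Implicit.
Unset Printing Implicit Defensive.

Import Order.TTheory GRing.Theory Num.Theory.
Import numFieldNormedType.Exports.

Local Open Scope classical_set_scope.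
Local Open Scope ring_scope.

(** * Expansions at 0 and their q-derivatives *)

Section QDerivativeOfExpansion.
Context {K : numFieldType}.
Implicit Types (q x : K) (f g : K -> K) (P : {poly K}) (A : set K).

Lemma is_derive_horner P x : is_derive x 1 (horner P) P^`().[x].
Proof.
elim/poly_ind: P => [|P c IH].
  have -> : horner (0 : {poly K}) = cst 0 by apply/funext => y; rewrite horner0.
  by rewrite deriv0 horner0; exact: is_derive_cst.
have -> : horner (P * 'X + c%:P) = (horner P * id + cst c)%R.
  by apply/funext => y; rewrite hornerMXaddC.
apply: is_derive_eq.
rewrite derivD derivC derivM derivX !addr0 mulr1 hornerD hornerMX addrC.
by rewrite -[_ *: 1]/(_ * 1) -[_ *: P^`().[x]]/(x * _) mulr1 mulrC.
Qed.

Lemma horner_cvg P x : P.[y] @[y --> x] --> P.[x].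
Proof.
apply: (@differentiable_continuous _ _ _ x (horner P)).
by apply/derivable1_diffP; exact: (@ex_derive _ _ _ _ _ _ _ (is_derive_horner P x)).
Qed.

Lemma is_deriveP f x (a : K) :
  is_derive x 1 f a <-> h^-1 * (f (h + x) - f x) @[h --> 0^'] --> a.
Proof.
have E : (fun h : K => h^-1 *: ((f \o shift x) (h *: (1 : K)) - f x)) =
         (fun h : K => h^-1 * (f (h + x) - f x)).
  by apply/funext => h /=; rewrite -[h *: 1]/(h * 1) mulr1.
split.
  by move=> [+ <-]; rewrite /derivable /derive E.
move=> fa; apply: DeriveDef.
  by rewrite /derivable E; apply/cvg_ex; exists a.
by rewrite /derive E; exact: cvg_lim.
Qed.

Lemma derive1_is_derive f x :
  derivable f x 1 -> is_derive x 1 f (f^`()%classic x).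
Proof. by rewrite derive1E => /derivableP. Qed.

Lemma is_derive_derive1 f x (a : K) : is_derive x 1 f a -> f^`()%classic x = a.
Proof. by move=> fa; rewrite derive1E derive_val. Qed.

(* The point [x = 0] is included, which forces [f 0 = P.[0]], also for [n = 0]. *)
Definition expands f P n :=
  forall e : K, 0 < e -> \forall x \near 0, `|f x - P.[x]| <= e * `|x| ^+ n.

Lemma expands_at0 f P n : expands f P n -> f 0 = P.[0].
Proof.
move=> fP; apply/eqP; rewrite -subr_eq0 -normr_le0; apply/ler_addgt0Pr => e e0.
rewrite add0r; apply: le_trans (nbhs_singleton (fP _ e0)) _.
rewrite normr0 expr0n; case: eqP => _; first by rewrite mulr1.
by rewrite mulr0 ltW.
Qed.

Lemma expands0_cvg f P : expands f P 0 -> f x @[x --> 0] --> P.[0].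
Proof.
move=> fP; apply: (@cvg_sub0 K K K (nbhs (0 : K)) _ f (horner P)); last exact: horner_cvg.
apply/cvgr0Pnorm_le => e e0; apply: filterS (fP _ e0) => x.
by rewrite expr0 mulr1.
Qed.

(** Since [f] and [P] agree at 0, their difference quotients there differ by at most [e] times
    |h|^n, hence by at most [e] once |h| <= 1. *)
Lemma expandsS_is_derive f P n : expands f P n.+1 -> is_derive (0 : K) (1 : K) f P`_1.
Proof.
move=> fP; have f0 := expands_at0 fP; apply/is_deriveP.
apply: (@cvg_sub0 K K K (0 : K)^' _ _
  (fun h : K => h^-1 * (P.[h + 0] - P.[0]))); last first.
  apply/is_deriveP; apply: is_derive_eq (is_derive_horner P 0) _.
  by rewrite horner_coef0 coef_deriv.
apply/cvgr0Pnorm_le => e e0.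
have H1 := nbhs_dnbhs (fP _ e0).
have H2 := nbhs_dnbhs (@nbhs0_le K K 1 ltr01).
near=> h.
have fh : `|f h - P.[h]| <= e * `|h| ^+ n.+1 by near: h.
have h1 : `|h| <= 1 by near: h.
have hN0 : h != 0 by near: h; exact: nbhs_dnbhs_neq.
rewrite !fctE -mulrBr !addr0 f0 opprB addrA subrK.
have nh : 0 < `|h| by rewrite normr_gt0.
rewrite normrM normfV ler_pdivrMl // mulrC; apply: le_trans fh _.
rewrite exprSr mulrA ler_pM2r // -[leRHS]mulr1 ler_pM2l //.
by apply: exprn_ile1.
Unshelve. all: by end_near. Qed.

Lemma derivable_expands f :
  derivable f (0 : K) (1 : K) -> expands f (f^`()%classic 0 *: 'X + (f 0)%:P) 1.
Proof.
move=> /derive1_is_derive/is_deriveP/cvgrPdist_le fd e e0.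
have := fd e e0; rewrite near_withinE; apply: filterS => x xd.
rewrite expr1 hornerD hornerZ hornerX hornerC.
have [->|x0] := eqVneq x 0; first by rewrite mulr0 add0r subrr !normr0 mulr0.
have /= := xd x0; rewrite addr0 -ler_pdivrMr ?normr_gt0 // -normfV -normrM.
rewrite distrC opprD addrA addrAC mulrBl -mulrA divff // mulr1.
by rewrite [x^-1 * _]mulrC.
Qed.

(** The inner sum is the q-number [i+1]_q, so that X^(i+1) is sent to [i+1]_q X^i. *)
Definition qderiv_poly q P : {poly K} :=
  \poly_(i < size P) ((\sum_(j < i.+1) q ^+ j) * P`_i.+1).

Lemma coef_qderiv_poly q P i :
  (qderiv_poly q P)`_i = (\sum_(j < i.+1) q ^+ j) * P`_i.+1.
Proof.
rewrite coef_poly; case: ltnP => // sP.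
by rewrite nth_default ?mulr0 // (leq_trans sP).
Qed.

(** The constant term [i = 0] carries the q-factorial of [m]; the induction needs every [i], as each
    step refers to the coefficient at [i.+1]. *)
Lemma coef_iter_qderiv_poly q P m i : (iter m (qderiv_poly q) P)`_i =
  (\prod_(j < m) \sum_(l < (i + j).+1) q ^+ l) * P`_(i + m).
Proof.
elim: m i => [|m IH] i; first by rewrite big_ord0 mul1r addn0.
rewrite iterS coef_qderiv_poly IH mulrA big_ord_recl addn0 addnS addSn.
by congr (_ * _ * _); apply: eq_bigr => j _; rewrite lift0 addnS.
Qed.

Lemma qderiv_polyE q P x : q != 1 -> x != 0 ->
  (qderiv_poly q P).[x] = (P.[x] - P.[q * x]) / ((1 - q) * x).
Proof.
move=> q1 x0; apply/esym/(canLR (mulfK _)).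
  by rewrite mulf_neq0 // subr_eq0 eq_sym.
(* Padding [P] by one zero coefficient leaves, after the constant terms cancel, exactly the [size P]
   terms of [qderiv_poly q P]. *)
rewrite horner_poly !(horner_coef_wide _ (leqnSn (size P))) -sumrB.
rewrite big_ord_recl !expr0 subrr add0r mulr_suml; apply: eq_bigr => i _.
rewrite lift0 exprMn exprS -mulrBr -[X in X - _]mul1r -mulrBl.
rewrite -[1 - q ^+ _]opprB subrX1 -mulNr opprB.
by rewrite -!mulrA; ring.
Qed.

Lemma qmul_cvg0 q : q * x @[x --> (0 : K)] --> (0 : K).
Proof. by have := @mulrl_continuous K q 0; rewrite /continuous_at mulr0. Qed.

Lemma expands_qderive q f P n : q != 1 -> expands f P n.+1 ->
  expands (qderive q f) (qderiv_poly q P) n.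
Proof.
move=> q1 fP e e0; set M := 1 + `|q| ^+ n.+1.
have M0 : 0 < M by rewrite ltr_wpDr // exprn_ge0.
have q10 : 0 < `|1 - q| by rewrite normr_gt0 subr_eq0 eq_sym.
(* The errors at [x] and [q * x] add up to at most [M] times this tolerance times |x|^(n+1);
   division by |1 - q| |x| then leaves e |x|^n. *)
have d0 : 0 < e * `|1 - q| / M by rewrite divr_gt0 // mulr_gt0.
have H1 := fP _ d0; have H2 := qmul_cvg0 q H1.
near=> x; have [->|x0] := eqVneq x 0.
  rewrite /qderive eqxx (is_derive_derive1 (expandsS_is_derive fP)).
  rewrite horner_coef0 coef_qderiv_poly big_ord1 expr0 mul1r subrr normr0.
  by rewrite mulr_ge0 ?exprn_ge0 // ltW.
rewrite qderiv_polyE // /qderive (negbTE x0) -mulrBl normrM normfV normrM.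
rewrite ler_pdivrMr ?mulr_gt0 ?normr_gt0 // ?subr_eq0 1?eq_sym //.
have -> : f x - f (q * x) - (P.[x] - P.[q * x]) =
  (f x - P.[x]) - (f (q * x) - P.[q * x]) by ring.
apply: le_trans (ler_normB _ _) _.
have h1 : `|f x - P.[x]| <= e * `|1 - q| / M * `|x| ^+ n.+1 by near: x.
have h2 : `|f (q * x) - P.[q * x]| <= e * `|1 - q| / M * `|q * x| ^+ n.+1.
  by near: x.
apply: le_trans (lerD h1 h2) _.
rewrite normrM exprMn -mulrDr.
have -> : `|x| ^+ n.+1 + `|q| ^+ n.+1 * `|x| ^+ n.+1 = M * `|x| ^+ n.+1.
  by rewrite mulrDl mul1r.
by rewrite mulrA divfK ?gt_eqF // exprSr mulrACA mulrA.
Unshelve. all: by end_near. Qed.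

Lemma qderiven_expands q f P n m : q != 1 -> expands f P n ->
  (m <= n)%N -> expands (qderiven q m f) (iter m (qderiv_poly q) P) (n - m).
Proof.
move=> q1 fP; elim: m => [|m IH] mn; first by rewrite subn0.
by apply: expands_qderive => //; rewrite subnSK //; apply: IH; exact: ltnW.
Qed.

(** Near 0, both [x] and [q * x] lie in the previous domain. At 0 itself, fewer than [n]
    q-derivatives leave an expansion of positive order, hence differentiability. *)
Lemma nbhs_qderive_dom q A f P n m : q != 1 -> nbhs 0 A -> expands f P n ->
  (m <= n)%N -> nbhs 0 (qderive_dom q A f m).
Proof.
move=> q1 A0 fP; elim: m => [//|m IH] mn.
have Dm := IH (ltnW mn); have Dqm := qmul_cvg0 q Dm.
apply: filterS2 Dm Dqm => x /= xD qxD.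
have [_|//] := eqVneq x 0; split; first exact: IH (ltnW mn).
have := qderiven_expands q1 fP (ltnW mn).
by rewrite -subnSK // => /expandsS_is_derive[].
Qed.

End QDerivativeOfExpansion.

(** * A mean value inequality, uniform in the real and complex cases *)

Section MeanValue.
Context {R : realType} {k : scalar_kind}.
Implicit Types (s t : R) (z : scalars R k).

Definition real_part z : R :=
  match k return scalars R k -> R with
  | RealScalars => id
  | ComplexScalars => @complex.Re R
  end z.

Lemma of_real0 : of_real k (0 : R) = 0. Proof. by case: k. Qed.

Lemma of_real1 : of_real k (1 : R) = 1. Proof. by case: k. Qed.

Lemma of_realD s t : of_real k (s + t) = of_real k s + of_real k t.
Proof. by case: k => //; exact: (rmorphD (complex.real_complex R)). Qed.

Lemma of_realV t : of_real k t^-1 = (of_real k t)^-1.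
Proof. by case: k => //; exact: (fmorphV (complex.real_complex R)). Qed.

Lemma of_real_inj : injective (of_real k : R -> scalars R k).
Proof. by case: k => //; exact: complex.complexI. Qed.

Lemma ler_of_real s t : (of_real k s <= of_real k t) = (s <= t).
Proof. by case: k => //; exact: complex.lecR. Qed.

Lemma norm_of_real t : `|of_real k t| = of_real k `|t|.
Proof.
by case: k => //=; rewrite complex.normc_def /= expr0n addr0 sqrtr_sqr.
Qed.

Lemma real_partB z1 z2 : real_part (z1 - z2) = real_part z1 - real_part z2.
Proof.
by rewrite /real_part; case: k z1 z2 => //= z1 z2; case: z1 z2 => [a b] [c d].
Qed.

Lemma real_partM t z : real_part (of_real k t * z) = t * real_part z.
Proof.
by rewrite /real_part; case: k z => //= -[a b] /=; rewrite mul0r subr0.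
Qed.

Lemma real_part1 : real_part 1 = 1.
Proof. by rewrite /real_part; case: k. Qed.

Lemma norm_real_part z : of_real k `|real_part z| <= `|z|.
Proof. by rewrite /real_part; case: k z => //= z; exact: complex.normc_ge_Re. Qed.

(** In the order on [R[i]], a positive element is real. *)
Lemma real_partK z : 0 < z -> of_real k (real_part z) = z.
Proof.
rewrite /real_part; case: k z => //= z z0.
by rewrite complex.RRe_real // realE ltW.
Qed.

Lemma real_part_gt0 z : 0 < z -> 0 < real_part z.
Proof.
move=> z0; have zE := real_partK z0.
rewrite lt_neqAle eq_sym -ler_of_real zE of_real0 ltW // andbT.
by apply: contraTN z0 => /eqP z0; rewrite -zE z0 of_real0 ltxx.
Qed.

Lemma dnbhs0_ray (x : scalars R k) (P : set (scalars R k)) : x != 0 ->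
  (\forall u \near (0 : scalars R k)^', P u) ->
  \forall h \near (0 : R)^', P (of_real k h * x).
Proof.
move=> x0; rewrite near_withinE => /nbhs_norm0P[d /= d0 dP].
have nx : 0 < `|x| by rewrite normr_gt0.
(* The radius [d] is a scalar; being positive, its quotient by |x| is real and bounds the real
   increments [h]. *)
have r0 := real_part_gt0 (divr_gt0 d0 nx).
near=> h; have h0 : h != 0 by near: h; exact: nbhs_dnbhs_neq.
have hd : `|h| < real_part (d / `|x|).
  by near: h; apply: nbhs_dnbhs; exact: (@nbhs0_lt R R).
apply: dP => /=; last first.
  by rewrite mulf_neq0 // -of_real0 (inj_eq of_real_inj).
rewrite normrM norm_of_real -ltr_pdivlMr // -(real_partK (divr_gt0 d0 nx)).
by rewrite lt_neqAle ler_of_real (inj_eq of_real_inj) -lt_neqAle.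
Unshelve. all: by end_near. Qed.

(** A chain rule from a real variable into the scalars: [real_part] is real-linear and does not
    increase norms, so the estimate for [g] carries over with the factor |x / w|. *)
Lemma is_derive_ray (g : scalars R k -> scalars R k) (a x w : scalars R k) t :
  x != 0 -> is_derive (of_real k t * x) 1 g a ->
  is_derive t 1 (fun s => real_part (g (of_real k s * x) / w))
    (real_part (a * x / w)).
Proof.
move=> x0 /is_deriveP/cvgrPdist_le ga; apply/is_deriveP/cvgrPdist_le => e e0.
(* Division by zero yields 0, so here both the function and its claimed derivative vanish. *)
have [->|w0] := eqVneq w 0.
  near=> h; rewrite invr0 !mulr0 -(mul0r 0) -of_real0 real_partM !mul0r.
  by rewrite subrr mulr0 subrr normr0 ltW.
have c0 : 0 < `|x / w| by rewrite normr_gt0 mulf_neq0 ?invr_eq0.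
have d0 : 0 < of_real k e / `|x / w|.
  by rewrite divr_gt0 // lt_neqAle -of_real0 ler_of_real ltW // andbT
             (inj_eq of_real_inj) lt_eqF.
apply: filterS (dnbhs0_ray x0 (ga _ d0)) => h.
rewrite ler_pdivlMr // => hga; rewrite -ler_of_real; apply: le_trans hga.
rewrite -normrM -real_partB -real_partM -real_partB of_realV.
apply: le_trans (norm_real_part _) _; rewrite le_eqVlt; apply/orP; left.
rewrite -mulrDl -of_realD invfM; apply/eqP; congr (`|_|).
(* The difference quotient along the ray is that of [g] for the increment [h x], scaled by
   [x / w]. *)
have E (F : fieldType) (b y z u v i : F) : y != 0 -> z != 0 ->
  b * y / z - i * (v / z - u / z) = (b - i / y * (v - u)) * (y / z).
  by move=> y0 z0; field; rewrite y0 z0.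
exact: E.
Unshelve. all: by end_near. Qed.

(* The classical mean value theorem applied to the real part of
   [t |-> g (t x) / (g x - g 0)], whose total increment is 1. *)
Lemma mean_value_inequality (g : scalars R k -> scalars R k) (x : scalars R k) :
  (forall t, 0 <= t <= 1 -> derivable g (of_real k t * x) 1) ->
  exists2 t, 0 <= t <= 1 &
    `|g x - g 0| <= `|g^`()%classic (of_real k t * x)| * `|x|.
Proof.
move=> dg; set w := g x - g 0.
have [w0|w0] := eqVneq w 0.
  by exists 0; rewrite ?lexx ?ler01 // w0 normr0 mulr_ge0.
have x0 : x != 0 by apply: contraNneq w0 => x0; rewrite /w x0 subrr.
set phi := fun s => real_part (g (of_real k s * x) / w).
have dphi (t : R) : 0 <= t <= 1 -> is_derive t 1 phi
    (real_part (g^`()%classic (of_real k t * x) * x / w)).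
  by move=> /dg/derive1_is_derive; exact: is_derive_ray.
have [||t t01] := @MVT R phi
    (fun t => real_part (g^`()%classic (of_real k t * x) * x / w)) 0 1 ltr01.
- by move=> t; rewrite in_itv /= => /andP[t0 t1]; apply: dphi; rewrite !ltW.
- apply: derivable_within_continuous => t; rewrite in_itv /= => t01.
  by have [] := dphi t t01.
rewrite subr0 mulr1 /phi -real_partB -mulrBl of_real1 of_real0 mul1r mul0r.
rewrite -/w divff // real_part1 => E.
exists t; first by move: t01; rewrite in_itv /= => /andP[t0 t1]; rewrite !ltW.
have := norm_real_part (g^`()%classic (of_real k t * x) * x / w).
rewrite -E normr1 of_real1 normrM normfV ler_pdivlMr ?normr_gt0 //.
by rewrite mul1r normrM.
Qed.

End MeanValue.

(** * Taylor's theorem with Peano remainder *)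

Section TaylorPeano.
Context {K : numFieldType}.
Implicit Types (f : K -> K) (A : set K).

(** [derive_dom] adds the outermost derivative last; the Taylor induction instead removes the first
    one and passes to f'. *)
Lemma derive_domSr A f n :
  derive_dom A f n.+1 = derive_dom (derive_dom A f 1) f^`()%classic n.
Proof.
elim: n => [//|n IH].
rewrite -[LHS]/[set x | differentiable_in (derive_dom A f n.+1)
                          f^`(n.+1)%classic x].
by rewrite IH derive1Sn.
Qed.

Lemma derive_dom_sub A f n : derive_dom A f n `<=` A.
Proof. by elim: n => [//|n IH] x [/interior_subset/IH]. Qed.

Lemma nbhs_derive_dom A f n :
  derive_dom A f n.+1 0 -> nbhs 0 (derive_dom A f n).
Proof. by case. Qed.

Definition taylor_poly f n : {poly K} :=
  \poly_(i < n.+1) (f^`(i)%classic 0 / i`!%:R).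

Lemma deriv_taylor_poly f n :
  (taylor_poly f n.+1)^`() = taylor_poly f^`()%classic n.
Proof.
apply/polyP => i; rewrite coef_deriv !coef_poly ltnS.
case: ifP => _; last by rewrite mul0rn.
rewrite derive1Sn -[LHS]mulr_natr factS natrM invfM -mulrA; congr (_ * _).
by rewrite mulrAC mulVf ?mul1r // pnatr_eq0.
Qed.

End TaylorPeano.

(** The derivative of the remainder of [f] is the remainder of f' one order lower. The induction
    hypothesis bounds it, and the mean value inequality contributes the missing factor |x|. *)
Lemma taylor_expands (R : realType) (k : scalar_kind) (A : set (scalars R k))
    (f : scalars R k -> scalars R k) (n : nat) :
  derive_dom A f n.+1 0 -> expands f (taylor_poly f n.+1) n.+1.
Proof.
elim: n A f => [|n IH] A f.
  move=> [_ /derivable_expands]; rewrite derive1n0.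
  congr (expands _ _ _); apply/polyP => i.
  rewrite coefD coefZ coefX coefC coef_poly.
  by case: i => [|[|i]] //=; rewrite ?(mulr0, mulr1, add0r, addr0, divr1).
move=> fn; have := fn; rewrite derive_domSr => f'n e e0.
have fdom : nbhs 0 (derive_dom A f 1).
  by apply: filterS (nbhs_derive_dom f'n); exact: derive_dom_sub.
have : \forall x \near (0 : scalars R k), derive_dom A f 1 x /\
    `|f^`()%classic x - (taylor_poly f^`()%classic n.+1).[x]| <= e * `|x| ^+ n.+1.
  exact: filterI fdom (IH _ _ f'n e e0).
(* A ball around 0 contains the whole segment from 0 to [x], along which the estimate for f' is
   needed. *)
move=> /nbhs_norm0P[d /= d0 dP]; apply/nbhs_norm0P; exists d => // x /= xd.
set P := taylor_poly f n.+2; set g := f - horner P.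
have ray t : 0 <= t <= 1 -> `|of_real k t * x| <= `|x|.
  move=> /andP[t0 t1]; rewrite normrM ler_piMl // norm_of_real.
  by rewrite -(of_real1 (k := k)) ler_of_real ger0_norm.
have dg t : 0 <= t <= 1 -> is_derive (of_real k t * x) 1 g
    (f^`()%classic (of_real k t * x) - P^`().[of_real k t * x]).
  move=> /ray tx; have [[_ ft] _] := dP _ (le_lt_trans tx xd).
  by apply: is_deriveB; [exact: derive1_is_derive|exact: is_derive_horner].
have [|t t01] := @mean_value_inequality R k g x; first by move=> t /dg[].
have -> : g x - g 0 = f x - P.[x].
  rewrite /g !fctE horner_coef0 coef_poly /= divr1.
  by rewrite subrr subr0.
move=> /le_trans; apply.
rewrite (is_derive_derive1 (dg t t01)) exprSr mulrA ler_wpM2r //.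
have [_ H] := dP _ (le_lt_trans (ray t t01) xd).
rewrite /P deriv_taylor_poly; apply: le_trans H _.
by rewrite ler_pM2l // lerXn2r ?nnegrE // ray.
Qed.

(** * The q-factorial constant and the conclusion *)

Lemma prod_qnumber (F : fieldType) (q : F) n : q != 1 ->
  \prod_(j < n) \sum_(l < j.+1) q ^+ l =
  qshifted_factorial q q n / (1 - q) ^+ n.
Proof.
move=> q1; have q10 : 1 - q != 0 by rewrite subr_eq0 eq_sym.
have -> : (1 - q) ^+ n = \prod_(j < n) (1 - q) by rewrite prodr_const card_ord.
rewrite /qshifted_factorial -prodf_div.
apply: eq_bigr => j _; apply: (canRL (mulfK q10)).
by rewrite -exprS -[RHS]opprB subrX1 -mulNr opprB mulrC.
Qed.

Theorem mainTheorem1 (R : realType) (q : R) (k : scalar_kind) (n : nat)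
    (A : set (scalars R k)) (f : scalars R k -> scalars R k) :
  q != 1 -> (0 < n)%N -> derive_dom A f n 0 ->
  let qK : scalars R k := of_real k q in
  let L : scalars R k :=
    f^`(n)%classic 0 / (n`!)%:R * (qshifted_factorial qK qK n / (1 - qK) ^+ n) in
  [/\ qderive_dom qK A f n 0,
      \forall x \near (0 : scalars R k)^', qderive_dom qK A f n x,
      qderiven qK n f 0 = L &
      qderiven qK n f x @[x --> (0 : scalars R k)^'] --> L].
Proof.
move=> q1; case: n => // n _ fn qK L.
have qK1 : qK != 1 by rewrite /qK -(of_real1 (k := k)) (inj_eq of_real_inj).
have fP := taylor_expands fn.
have A0 : nbhs 0 A.
  by apply: filterS (nbhs_derive_dom fn); exact: derive_dom_sub.
have domn := nbhs_qderive_dom qK1 A0 fP (leqnn n.+1).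
have := qderiven_expands qK1 fP (leqnn n.+1); rewrite subnn.
(* The constant term of [Q] is the Taylor coefficient of order [n.+1] times the q-factorial of
   [n.+1]. *)
set Q := iter _ _ _ => Qn; have QL : Q.[0] = L.
  rewrite horner_coef0 coef_iter_qderiv_poly add0n coef_poly ltnSn mulrC.
  by rewrite /L -prod_qnumber.
split; first exact: nbhs_singleton domn.
- exact: nbhs_dnbhs domn.
- by rewrite (expands_at0 Qn).
- rewrite -QL; apply: cvg_trans (expands0_cvg Qn).
  by apply: cvg_app; exact: nbhs_dnbhs.
Qed.
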